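(* Consider a numerical solution $\{(\mathbf c^{n},\mathbf f^{n})\}_{n\ge0}$ of the predictor-corrector full discretization described in the context, and the fully discrete energy $$ \begin{aligned} E^{n+1/2} ={}& \left((\varrho^h)^{1/2}D_t\mathbf f^n,(\varrho^h)^{1/2}D_t\mathbf f^n\right)_{hw}+\left((\varrho^{2h})^{1/2}D_t\mathbf c^n,(\varrho^{2h})^{1/2}D_t\mathbf c^n\right)_{2hw}\\ &+\mathcal S_{2h}(\mathbf c^{n+1},\mathbf c^n)+\mathcal S_h(\mathbf f^{n+1},\mathbf f^n)\\ &-\frac{\Delta_t^2}{12}\left((\mathcal J^h)^{-1}\hat{\mathcal L}^h\mathbf f^{n+1},(\mathcal J^h_\rho)^{-1}\hat{\mathcal L}^h\mathbf f^n\right)_{hw}-\frac{\Delta_t^2}{12}\left((\mathcal J^{2h})^{-1}\widetilde{\mathcal L}^{2h}\mathbf c^{n+1},(\mathcal J^{2h}_\rho)^{-1}\widetilde{\mathcal L}^{2h}\mathbf c^n\right)_{2hw}. \end{aligned} $$ Under the time step restriction $$ \Delta_t\le\min\left\{\frac{2\sqrt3}{\max_j\sqrt{\kappa^h_j}},\ \frac{2\sqrt3}{\max_j\sqrt{\kappa^{2h}_j}}\right\}, $$ where $\kappa_j^h$ and $\kappa_j^{2h}$ are the $j$-th eigenvalues of $\bar K_h$ and $\bar K_{2h}$, respectively, the energy is conserved: for every $n\ge1$, $$E^{n+1/2}=E^{n-1/2}.$$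
   Context: **Continuous data.** The 2D elastic wave equation is posed in two subdomains $\Omega^c$ (coarse, below) and $\Omega^f$ (fine, above), images of $[0,1]^2\ni(r,s)$ under smooth one-to-one maps $\mathbf X^c,\mathbf X^f$ with Jacobians $J^c,J^f>0$. The interface $\Gamma$ is $s=1$ for $\Omega^c$ and $s=0$ for $\Omega^f$. For $\ast\in\{c,f\}$: $\rho^\ast>0$ is the density; $N^\ast_{kj}$ ($k,j=1,2$) are $2\times2$ matrix-valued material functions with $N^\ast_{kk}$ symmetric positive definite and $N^\ast_{kj}=(N^\ast_{jk})^T$; $\Lambda^\ast=\sqrt{(\partial s/\partial x)^2+(\partial s/\partial y)^2}>0$. The equations are $\rho^\ast J^\ast\mathbf U_{tt}=\partial_r(N^\ast_{11}\mathbf U_r)+\partial_r(N^\ast_{12}\mathbf U_s)+\partial_s(N^\ast_{21}\mathbf U_r)+\partial_s(N^\ast_{22}\mathbf U_s)$. **Grids.** $h_1(n_1^h-1)=1=h_2(n_2^h-1)$ and $2h_1(n_1^{2h}-1)=1=2h_2(n_2^{2h}-1)$. $I_{\Omega^c}=\{1\le i\le n_1^{2h},1\le j\le n_2^{2h}\}$, $I_{\Gamma^c}=\{j=n_2^{2h}\}$ in it; $I_{\Omega^f}=\{1\le i\le n_1^{h},1\le j\le n_2^{h}\}$, $I_{\Gamma^f}=\{j=1\}$ in it. Grid functions take values in $\mathbb R^2$. The vector $\mathbf f$ has values on $I_{\Omega^f}$ (no ghost points); $\mathbf c$ has values on $I_{\Omega^c}$ and additionally on the line of ghost points $j=n_2^{2h}+1$.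 Inner products and the forms $\mathcal S$ below use only non-ghost values. A tilde over an operator means it uses ghost points. **One-dimensional operators.** On a uniform grid $x_1,\dots,x_n$ with spacing $h$, $(u,v)_{hw1}=h\sum_{j=1}^n\omega_ju_jv_j$ with weights $\omega_j>0$. A first derivative SBP operator $D$ satisfies $(u,Dv)_{hw1}=-(Du,v)_{hw1}-u_1v_1+u_nv_n$. A second derivative SBP operator $G(\gamma)\approx\frac{d}{dx}(\gamma\frac{d}{dx})$ satisfies $(u,G(\gamma)v)_{hw1}=-S_\gamma(u,v)-\gamma_1u_1b_1v+\gamma_nu_nb_nv$ with $S_\gamma$ symmetric positive semidefinite, not using ghost points, and $b_1v,b_nv$ approximating the first derivative at $x_1,x_n$. It is written $G$ if no ghost points are used, and $\widetilde G$ if ghost points are used (in $b_1,b_n$ and the first/last row). **Two-dimensional operators.** Subscript 1 (resp. 2) denotes application along grid lines in $r$ (resp. $s$); superscripts $h,2h$ denote fine/coarse grid; matrix coefficients act componentwise, e.g. $(G_1(N_{11})\mathbf u)_p=\sum_{q=1}^2G_1(N_{11}(p,q))u^{(q)}$. Define $$\widetilde{\mathcal L}^{2h}\mathbf c=G_1^{2h}(N_{11}^{2h})\mathbf c+\widetilde G_2^{2h}(N_{22}^{2h})\mathbf c+D_1^{2h}(N_{12}^{2h}D_2^{2h}\mathbf c)+D_2^{2h}(N_{21}^{2h}D_1^{2h}\mathbf c),$$ $$\mathcal L^{h}\mathbf f=G_1^{h}(N_{11}^{h})\mathbf f+G_2^{h}(N_{22}^{h})\mathbf f+D_1^{h}(N_{12}^{h}D_2^{h}\mathbf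 f)+D_2^{h}(N_{21}^{h}D_1^{h}\mathbf f),$$ and, on $\Gamma$, the traction operators $\widetilde{\mathcal A}_2^{2h}\mathbf c=N_{21}^{2h}D_1^{2h}\mathbf c+N_{22}^{2h}\widetilde{\mathcal D}_2^{2h}\mathbf c$ and $\mathcal A_2^h\mathbf f=N_{21}^hD_1^h\mathbf f+N_{22}^h\mathcal D_2^h\mathbf f$, where $\widetilde{\mathcal D}^{2h}_2$, $\mathcal D_2^h$ are the boundary first derivative approximations ($b_n$ at $s=1$ with ghost points, $b_1$ at $s=0$ without) associated with $\widetilde G_2^{2h}$, $G_2^h$. **Diagonal matrices and inner products.** $\mathbf I$ is the $2\times 2$ identity. $J^h,\rho^h$ (resp. $J^{2h},\rho^{2h}$) are diagonal matrices of grid values of $J^f,\rho^f$ (resp. $J^c,\rho^c$). For $g\in\{h,2h\}$: $\mathcal J^g=J^g\otimes\mathbf I$, $\varrho^g=\rho^g\otimes\mathbf I$, $\mathcal J_\rho^g=(\rho^gJ^g)\otimes\mathbf I$, $\mathcal J^g_{\Gamma\Lambda}=(J^g_\Gamma\Lambda^g)\otimes\mathbf I$ (grid values of $J$ and $\Lambda$ on $\Gamma$). $W^g$ is the diagonal matrix with entry $\omega_i\omega_j$ at grid point $(i,j)$ (products of the 1D SBP weights), $\mathcal W^g=W^g\otimes\mathbf I$, and $\mathcal W_\Gamma^g=W^g_\Gamma\otimes\mathbf I$ with $W_\Gamma^g=\mathrm{diag}(\omega_i)$ the 1D weights along $\Gamma$. Inner products: $(\mathbf v,\mathbf u)_{hw}=h_1h_2\mathbf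 v^T\mathcal W^h\mathcal J^h\mathbf u$, $(\mathbf v,\mathbf u)_{2hw}=4h_1h_2\mathbf v^T\mathcal W^{2h}\mathcal J^{2h}\mathbf u$; on $\Gamma$: $\langle\mathbf u,\mathbf v\rangle_{hw}=h_1\mathbf u^T\mathcal W_\Gamma^h\mathcal J^h_{\Gamma\Lambda}\mathbf v$, $\langle\mathbf u,\mathbf v\rangle_{2hw}=2h_1\mathbf u^T\mathcal W_\Gamma^{2h}\mathcal J^{2h}_{\Gamma\Lambda}\mathbf v$. **Summation-by-parts identities.** All contributions from physical boundaries (boundaries other than $\Gamma$) are omitted throughout. With this convention the spatial operators satisfy, for all grid functions ($\mathbf v|_\Gamma$ being the restriction to the interface), $$(\mathbf v,(\mathcal J^{2h})^{-1}\widetilde{\mathcal L}^{2h}\mathbf u)_{2hw}=-\mathcal S_{2h}(\mathbf v,\mathbf u)+\langle\mathbf v|_\Gamma,(\mathcal J_{\Gamma\Lambda}^{2h})^{-1}\widetilde{\mathcal A}_2^{2h}\mathbf u\rangle_{2hw},$$ $$(\mathbf v,(\mathcal J^{h})^{-1}\mathcal L^{h}\mathbf u)_{hw}=-\mathcal S_{h}(\mathbf v,\mathbf u)-\langle\mathbf v|_\Gamma,(\mathcal J_{\Gamma\Lambda}^{h})^{-1}\mathcal A_2^{h}\mathbf u\rangle_{hw},$$ where $\mathcal S_{2h},\mathcal S_h$ are symmetric positive semidefinite bilinear forms not involving ghost points. **Interpolation.** $P$ ($n_1^h\times n_1^{2h}$) and $R$ ($n_1^{2h}\times n_1^h$) are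 interpolation and restriction matrices satisfying the compatibility condition $h_1\,v_f^TW_\Gamma^hPv_c=2h_1\,v_c^TW_\Gamma^{2h}Rv_f$ for all $v_c,v_f$. Scaled operators: $\mathcal P=(\mathcal J_{\Gamma\Lambda}^h)^{-1/2}(P\otimes\mathbf I)(\mathcal J_{\Gamma\Lambda}^{2h})^{1/2}$, $\mathcal R=(\mathcal J_{\Gamma\Lambda}^{2h})^{-1/2}(R\otimes\mathbf I)(\mathcal J_{\Gamma\Lambda}^{h})^{1/2}$. $\mathcal P(\mathbf c)$ means $\mathcal P$ applied to $\mathbf c|_\Gamma$. **Interface quantities.** For $(\mathbf c,\mathbf f)$ let $\boldsymbol\eta=\mathcal J^h_\rho|_\Gamma\,\mathcal P\big((\mathcal J^{2h}_\rho)^{-1}\widetilde{\mathcal L}^{2h}\mathbf c|_\Gamma\big)-\mathcal L^h\mathbf f|_\Gamma$, and let $\hat{\mathcal L}^h\mathbf f$ be $\mathcal L^h\mathbf f+\boldsymbol\eta$ on $I_{\Gamma^f}$ and $\mathcal L^h\mathbf f$ on $I_{\Omega^f}\setminus I_{\Gamma^f}$ (so $\hat{\mathcal L}^h\mathbf f$ depends on the accompanying $\mathbf c$). The discrete interface conditions are (continuity of solution) $\mathbf f|_\Gamma=\mathcal P(\mathbf c)$; (continuity of traction) $(\mathcal J_{\Gamma\Lambda}^{2h})^{-1}\widetilde{\mathcal A}_2^{2h}\mathbf c=\mathcal R\big((\mathcal J_{\Gamma\Lambda}^h)^{-1}(\mathcal A_2^h\mathbf f-h_2\omega_1\boldsymbol\eta)\big)$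 on $I_{\Gamma^c}$, where $\omega_1$ is the 1D SBP weight at the first grid point. **Full discretization** (step size $\Delta_t>0$, no forcing). Given $(\mathbf c^{n-1},\mathbf f^{n-1})$ and $(\mathbf c^n,\mathbf f^n)$ satisfying both interface conditions: 1. $\mathbf c^{\ast,n+1}=2\mathbf c^n-\mathbf c^{n-1}+\Delta_t^2(\mathcal J^{2h}_\rho)^{-1}\widetilde{\mathcal L}^{2h}\mathbf c^n$ on $I_{\Omega^c}$; $\mathbf f^{\ast,n+1}=2\mathbf f^n-\mathbf f^{n-1}+\Delta_t^2(\mathcal J^{h}_\rho)^{-1}\hat{\mathcal L}^{h}\mathbf f^n$ on $I_{\Omega^f}\setminus I_{\Gamma^f}$. 2. $\mathbf f^{\ast,n+1}|_\Gamma=\mathcal P(\mathbf c^{\ast,n+1})$. 3. The ghost values of $\mathbf c^{\ast,n+1}$ are determined by the continuity of traction for $(\mathbf c^{\ast,n+1},\mathbf f^{\ast,n+1})$. 4. $\mathbf a_c^n=(\mathbf c^{\ast,n+1}-2\mathbf c^n+\mathbf c^{n-1})/\Delta_t^2$, $\mathbf a_f^n=(\mathbf f^{\ast,n+1}-2\mathbf f^n+\mathbf f^{n-1})/\Delta_t^2$ at all grid points (including ghost points for $\mathbf a_c^n$). 5. $\mathbf c^{n+1}=\mathbf c^{\ast,n+1}+\frac{\Delta_t^4}{12}(\mathcal J^{2h}_\rho)^{-1}\widetilde{\mathcal L}^{2h}\mathbf a_c^n$ on $I_{\Omega^c}$; $\mathbf f^{n+1}=\mathbf f^{\ast,n+1}+\frac{\Delta_t^4}{12}(\mathcal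 J^{h}_\rho)^{-1}\hat{\mathcal L}^{h}\mathbf a_f^n$ on $I_{\Omega^f}\setminus I_{\Gamma^f}$. 6. $\mathbf f^{n+1}|_\Gamma=\mathcal P(\mathbf c^{n+1})$. 7. The ghost values of $\mathbf c^{n+1}$ are determined by the continuity of traction for $(\mathbf c^{n+1},\mathbf f^{n+1})$. The ghost-point systems in steps 3 and 7 are assumed solvable. The starting data $(\mathbf c^0,\mathbf f^0),(\mathbf c^1,\mathbf f^1)$ satisfy both interface conditions. **Notation in the energy.** $D_t\mathbf c^n=(\mathbf c^{n+1}-\mathbf c^n)/\Delta_t$, and likewise for $\mathbf f$. $K_h,K_{2h}$ are the square matrices with $\mathcal S_h(\mathbf v,\mathbf u)=(\mathbf v,\varrho^hK_h\mathbf u)_{hw}$ and $\mathcal S_{2h}(\mathbf v,\mathbf u)=(\mathbf v,\varrho^{2h}K_{2h}\mathbf u)_{2hw}$ for all grid functions. $\bar K_h=(\mathcal W^h_\rho)^{1/2}K_h(\mathcal W_\rho^h)^{-1/2}$, $\bar K_{2h}=(\mathcal W^{2h}_\rho)^{1/2}K_{2h}(\mathcal W_\rho^{2h})^{-1/2}$, with $\mathcal W_\rho^g=(\rho^gW^g)\otimes\mathbf I$; their eigenvalues are real and nonnegative. *)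

(* Defs.v *)
From mathcomp Require Import all_boot all_order all_algebra.
From mathcomp Require Import all_classical all_reals all_analysis.

Set Implicit Arguments.
Unset Strict Implicit.
Unset Printing Implicit Defensive.

Import Order.TTheory GRing.Theory Num.Theory.
Import numFieldNormedType.Exports.
Local Open Scope classical_set_scope.
Local Open Scope ring_scope.

Definition partial1 (R : realType) (f : R * R -> R) (p : R * R) : R :=
  derive1 (fun t : R => f (t, p.2)) p.1.

Definition partial2 (R : realType) (f : R * R -> R) (p : R * R) : R :=
  derive1 (fun t : R => f (p.1, t)) p.2.

Fixpoint Ck (R : realType) (k : nat) (U : set (R * R)) (f : R * R -> R) : Prop :=
  (forall p, U p -> {for p, continuous f}) /\
  if k is k'.+1 then
    [/\ forall p, U p -> derivable (fun t : R => f (t, p.2)) p.1 1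
                      /\ derivable (fun t : R => f (p.1, t)) p.2 1,
        Ck k' U (partial1 f)
      & Ck k' U (partial2 f)]
  else True.

Definition smooth_on (R : realType) (U : set (R * R)) (f : R * R -> R) : Prop :=
  forall k, Ck k U f.

Definition unit_square (R : realType) : set (R * R) :=
  [set p | 0 <= p.1 <= 1 /\ 0 <= p.2 <= 1].

Definition jacobian (R : realType) (X : R * R -> R * R) (p : R * R) : R :=
  partial1 (fun q => (X q).1) p * partial2 (fun q => (X q).2) p
  - partial2 (fun q => (X q).1) p * partial1 (fun q => (X q).2) p.

(* sqrt (s_x ^ 2 + s_y ^ 2) at the point X p, where Y = (r, s) inverts X.     *)
Definition metric (R : realType) (X Y : R * R -> R * R) (p : R * R) : R :=
  Num.sqrt (partial1 (fun q => (Y q).2) (X p) ^+ 2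
          + partial2 (fun q => (Y q).2) (X p) ^+ 2).

Definition spd (R : realType) (n : nat) (A : 'M[R]_n) : Prop :=
  A^T = A /\ forall v : 'cV[R]_n, v != 0 -> 0 < (v^T *m A *m v) 0 0.

(* One curvilinear subdomain with its material. The map is smooth up to the   *)
(* boundary of the square in the sense of being given on an open neighborhood *)
(* [bdom] of it, so that the partial derivatives of [bmap] on the square, and *)
(* those of the inverse [binv] on its image, are ordinary two-sided ones. The *)
(* values of [binv] away from the image of [bdom] are irrelevant. Indices 1, 2*)
(* of N_kj are (0 : 'I_2), (1 : 'I_2).                                        *)
Record block (R : realType) := Block {
  bmap : R * R -> R * R ;
  binv : R * R -> R * R ;
  bdom : set (R * R) ;
  brho : R * R -> R ;
  bmat : 'I_2 -> 'I_2 -> R * R -> 'M[R]_2 ;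
  bdom_open : open bdom ;
  bdom_square : @unit_square R `<=` bdom ;
  bmap_smooth1 : smooth_on bdom (fun p => (bmap p).1) ;
  bmap_smooth2 : smooth_on bdom (fun p => (bmap p).2) ;
  bmapK : forall p, bdom p -> binv (bmap p) = p ;
  bjac_gt0 : forall p, unit_square p -> 0 < jacobian bmap p ;
  bmetric_gt0 : forall p, unit_square p -> 0 < metric bmap binv p ;
  brho_gt0 : forall p, unit_square p -> 0 < brho p ;
  bmat_spd : forall k p, unit_square p -> spd (bmat k k p) ;
  bmat_tr : forall k j p, unit_square p -> bmat k j p = (bmat j k p)^T
}.

(* Operators on a grid of n.+1 points. The first derivative [dop] acts on the *)
(* n.+1 grid values; the second derivative [gop] and the boundary derivatives *)
(* [bfst], [blst] (b_1 and b_n) act on m >= n.+1 values, grid and ghost.      *)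
Record sbp_ops (R : realType) (n m : nat) := SbpOps {
  wt : 'I_n.+1 -> R ;
  dop : 'M[R]_n.+1 ;
  gop : ('I_n.+1 -> R) -> 'M[R]_(n.+1, m) ;
  bfst : 'rV[R]_m ;
  blst : 'rV[R]_m
}.

Definition ip1 (R : realType) (n : nat) (h : R) (w : 'I_n.+1 -> R)
    (u v : 'cV[R]_n.+1) : R :=
  h * \sum_(j < n.+1) w j * u j 0 * v j 0.

(* The booleans [lft] and [rgt] tell whether the first, resp. last, grid      *)
(* point lies on the interface; at an end that belongs to a physical boundary *)
(* the boundary contribution is omitted. With lft = rgt = true these are the  *)
(* usual SBP identities.                                                      *)
Definition sbp_first (R : realType) (n : nat) (h : R) (lft rgt : bool)
    (w : 'I_n.+1 -> R) (D : 'M[R]_n.+1) : Prop :=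
  forall u v : 'cV[R]_n.+1,
    ip1 h w u (D *m v) = - ip1 h w (D *m u) v
      - (if lft then u ord0 0 * v ord0 0 else 0)
      + (if rgt then u ord_max 0 * v ord_max 0 else 0).

(* [e] embeds the grid points among the grid and ghost points, so that        *)
(* [rowsub e v] forgets the ghost values. Coefficients need not be positive,  *)
(* since gop is also used with off-diagonal entries of N_kk; positivity of    *)
(* S_gamma is claimed for positive gamma only.                                *)
Definition sbp_second (R : realType) (n m : nat) (e : 'I_n.+1 -> 'I_m) (h : R)
    (lft rgt : bool) (w : 'I_n.+1 -> R)
    (G : ('I_n.+1 -> R) -> 'M[R]_(n.+1, m)) (b1 bn : 'rV[R]_m) : Prop :=
  forall g : 'I_n.+1 -> R, exists S : 'M[R]_n.+1,
    [/\ S^T = S,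
        (forall j, 0 < g j) -> forall u : 'cV[R]_n.+1, 0 <= (u^T *m S *m u) 0 0
      & forall (u : 'cV[R]_n.+1) (v : 'cV[R]_m),
          ip1 h w u (G g *m v) = - (u^T *m S *m rowsub e v) 0 0
            - (if lft then g ord0 * u ord0 0 * (b1 *m v) 0 0 else 0)
            + (if rgt then g ord_max * u ord_max 0 * (bn *m v) 0 0 else 0)].

Definition is_sbp (R : realType) (n m : nat) (e : 'I_n.+1 -> 'I_m) (h : R)
    (lft rgt : bool) (o : sbp_ops R n m) : Prop :=
  [/\ forall j, 0 < wt o j,
      sbp_first h lft rgt (wt o) (dop o)
    & sbp_second e h lft rgt (wt o) (gop o) (bfst o) (blst o)].

Definition gridfun (R : realType) (m n : nat) := 'I_m -> 'I_n -> 'cV[R]_2.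

Definition linefun (R : realType) (m : nat) := 'I_m -> 'cV[R]_2.

Definition along1 (R : realType) (m m' n : nat) (A : 'M[R]_(m', m))
    (u : gridfun R m n) : gridfun R m' n :=
  fun i j => \sum_k A i k *: u k j.

Definition along2 (R : realType) (m n n' : nat) (A : 'M[R]_(n', n))
    (u : gridfun R m n) : gridfun R m n' :=
  fun i j => \sum_k A j k *: u i k.

Definition G1op (R : realType) (n1 n2 : nat) (o : sbp_ops R n1 n1.+1)
    (N : 'I_n1.+1 -> 'I_n2.+1 -> 'M[R]_2) (u : gridfun R n1.+1 n2.+1) :
    gridfun R n1.+1 n2.+1 :=
  fun i j => \col_p \sum_q \sum_k
    gop o (fun i' => N i' j p q) i k * u k j q 0.

Definition G2op (R : realType) (n1 n2 m : nat) (o : sbp_ops R n2 m)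
    (N : 'I_n1.+1 -> 'I_n2.+1 -> 'M[R]_2) (u : gridfun R n1.+1 m) :
    gridfun R n1.+1 n2.+1 :=
  fun i j => \col_p \sum_q \sum_k
    gop o (fun j' => N i j' p q) j k * u i k q 0.

Definition mulN (R : realType) (m n : nat) (N : 'I_m -> 'I_n -> 'M[R]_2)
    (u : gridfun R m n) : gridfun R m n :=
  fun i j => N i j *m u i j.

(* The spatial operator; [e] as in [sbp_second], in the s direction.          *)
Definition Lop (R : realType) (n1 n2 m : nat) (e : 'I_n2.+1 -> 'I_m)
    (o1 : sbp_ops R n1 n1.+1) (o2 : sbp_ops R n2 m)
    (N : 'I_2 -> 'I_2 -> 'I_n1.+1 -> 'I_n2.+1 -> 'M[R]_2)
    (u : gridfun R n1.+1 m) : gridfun R n1.+1 n2.+1 :=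
  let u0 : gridfun R n1.+1 n2.+1 := fun i j => u i (e j) in
  fun i j => G1op o1 (N 0 0) u0 i j + G2op o2 (N 1 1) u i j
    + along1 (dop o1) (mulN (N 0 1) (along2 (dop o2) u0)) i j
    + along2 (dop o2) (mulN (N 1 0) (along1 (dop o1) u0)) i j.

(* The traction operator on the grid line of index [jG], where [b] is the     *)
(* boundary derivative (b_1 or b_n) attached to that line.                    *)
Definition Aop (R : realType) (n1 n2 m : nat) (e : 'I_n2.+1 -> 'I_m)
    (o1 : sbp_ops R n1 n1.+1) (b : 'rV[R]_m) (jG : 'I_n2.+1)
    (N : 'I_2 -> 'I_2 -> 'I_n1.+1 -> 'I_n2.+1 -> 'M[R]_2)
    (u : gridfun R n1.+1 m) : linefun R n1.+1 :=
  let u0 : gridfun R n1.+1 n2.+1 := fun i j => u i (e j) in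
  fun i => N 1 0 i jG *m along1 (dop o1) u0 i jG
         + N 1 1 i jG *m (\sum_k b 0 k *: u i k).

Definition dot (R : realType) (u v : 'cV[R]_2) : R := (u^T *m v) 0 0.

Definition ip2 (R : realType) (m n : nat) (a : R) (w1 : 'I_m -> R)
    (w2 : 'I_n -> R) (J : 'I_m -> 'I_n -> R) (u v : gridfun R m n) : R :=
  a * \sum_i \sum_j w1 i * w2 j * J i j * dot (u i j) (v i j).

Definition ipG (R : realType) (m : nat) (a : R) (w : 'I_m -> R)
    (JL : 'I_m -> R) (u v : linefun R m) : R :=
  a * \sum_i w i * JL i * dot (u i) (v i).

Definition sym_psd_form (R : realType) (m n : nat)
    (S : gridfun R m n -> gridfun R m n -> R) : Prop :=
  [/\ forall (a : R) u v w,
        S (fun i j => a *: u i j + v i j) w = a * S u w + S v w,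
      forall u v, S u v = S v u
    & forall u, 0 <= S u u].

(* Grid indices start at 0 and nf1, nf2, nc1, nc2 are the last ones:          *)
(* n_1^h = nf1.+1, n_2^h = nf2.+1, n_1^{2h} = nc1.+1, n_2^{2h} = nc2.+1.      *)
(* The interface is the line j = nc2 of the coarse grid and the line j = 0 of *)
(* the fine grid; the other three sides of each block are physical            *)
(* boundaries. Only the s direction of the coarse grid has ghost points, the  *)
(* line j = nc2.+1.                                                           *)
Record discretization (R : realType) := Discretization {
  nf1 : nat ; nf2 : nat ; nc1 : nat ; nc2 : nat ;
  h1 : R ; h2 : R ;
  bc : block R ;
  bf : block R ;
  of1 : sbp_ops R nf1 nf1.+1 ;
  of2 : sbp_ops R nf2 nf2.+1 ;
  oc1 : sbp_ops R nc1 nc1.+1 ;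
  oc2 : sbp_ops R nc2 nc2.+2 ;
  Pint : 'M[R]_(nf1.+1, nc1.+1) ;
  Rint : 'M[R]_(nc1.+1, nf1.+1) ;
  h1_nf1 : h1 * nf1%:R = 1 ;
  h2_nf2 : h2 * nf2%:R = 1 ;
  h1_nc1 : 2 * h1 * nc1%:R = 1 ;
  h2_nc2 : 2 * h2 * nc2%:R = 1 ;
  interface : [set bmap bc (r, 1) | r in [set r : R | 0 <= r <= 1]]
            = [set bmap bf (r, 0) | r in [set r : R | 0 <= r <= 1]] ;
  of1_sbp : is_sbp id h1 false false of1 ;
  of2_sbp : is_sbp id h2 true false of2 ;
  oc1_sbp : is_sbp id (2 * h1) false false oc1 ;
  oc2_sbp : is_sbp (widen_ord (leqnSn nc2.+1)) (2 * h2) false true oc2 ;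
  int_compat : forall (vf : 'cV[R]_nf1.+1) (vc : 'cV[R]_nc1.+1),
    h1 * (vf^T *m diag_mx (\row_i wt of1 i) *m Pint *m vc) 0 0
    = 2 * h1 * (vc^T *m diag_mx (\row_i wt oc1 i) *m Rint *m vf) 0 0
}.

Definition fgrid (R : realType) (d : discretization R) :=
  gridfun R (nf1 d).+1 (nf2 d).+1.
Definition cgrid (R : realType) (d : discretization R) :=
  gridfun R (nc1 d).+1 (nc2 d).+1.
Definition cgrid_ghost (R : realType) (d : discretization R) :=
  gridfun R (nc1 d).+1 (nc2 d).+2.
Definition fline (R : realType) (d : discretization R) := linefun R (nf1 d).+1.
Definition cline (R : realType) (d : discretization R) := linefun R (nc1 d).+1.

Definition cemb (R : realType) (d : discretization R) :
    'I_(nc2 d).+1 -> 'I_(nc2 d).+2 :=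
  widen_ord (leqnSn (nc2 d).+1).

Definition noghost (R : realType) (d : discretization R) (c : cgrid_ghost d) :
    cgrid d :=
  fun i j => c i (cemb j).

Definition ptf (R : realType) (d : discretization R)
    (i : 'I_(nf1 d).+1) (j : 'I_(nf2 d).+1) : R * R :=
  (i%:R * h1 d, j%:R * h2 d).
Definition ptc (R : realType) (d : discretization R)
    (i : 'I_(nc1 d).+1) (j : 'I_(nc2 d).+1) : R * R :=
  (i%:R * (2 * h1 d), j%:R * (2 * h2 d)).

Definition Jf (R : realType) (d : discretization R) i j : R :=
  jacobian (bmap (bf d)) (@ptf R d i j).
Definition Jc (R : realType) (d : discretization R) i j : R :=
  jacobian (bmap (bc d)) (@ptc R d i j).
Definition rhof (R : realType) (d : discretization R) i j : R :=
  brho (bf d) (@ptf R d i j).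
Definition rhoc (R : realType) (d : discretization R) i j : R :=
  brho (bc d) (@ptc R d i j).
Definition Nf (R : realType) (d : discretization R) k l i j : 'M[R]_2 :=
  bmat (bf d) k l (@ptf R d i j).
Definition Nc (R : realType) (d : discretization R) k l i j : 'M[R]_2 :=
  bmat (bc d) k l (@ptc R d i j).

Definition JLf (R : realType) (d : discretization R) (i : 'I_(nf1 d).+1) : R :=
  Jf i ord0 * metric (bmap (bf d)) (binv (bf d)) (@ptf R d i ord0).
Definition JLc (R : realType) (d : discretization R) (i : 'I_(nc1 d).+1) : R :=
  Jc i ord_max * metric (bmap (bc d)) (binv (bc d)) (@ptc R d i ord_max).

Definition ipf (R : realType) (d : discretization R) (u v : fgrid d) : R :=
  ip2 (h1 d * h2 d) (wt (of1 d)) (wt (of2 d)) (@Jf R d) u v.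
Definition ipc (R : realType) (d : discretization R) (u v : cgrid d) : R :=
  ip2 (4 * h1 d * h2 d) (wt (oc1 d)) (wt (oc2 d)) (@Jc R d) u v.
Definition ipGf (R : realType) (d : discretization R) (u v : fline d) : R :=
  ipG (h1 d) (wt (of1 d)) (@JLf R d) u v.
Definition ipGc (R : realType) (d : discretization R) (u v : cline d) : R :=
  ipG (2 * h1 d) (wt (oc1 d)) (@JLc R d) u v.

Definition Lf (R : realType) (d : discretization R) (f : fgrid d) : fgrid d :=
  Lop id (of1 d) (of2 d) (@Nf R d) f.
Definition Lc (R : realType) (d : discretization R) (c : cgrid_ghost d) :
    cgrid d :=
  Lop (@cemb R d) (oc1 d) (oc2 d) (@Nc R d) c.
Definition Af (R : realType) (d : discretization R) (f : fgrid d) : fline d :=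
  Aop id (of1 d) (bfst (of2 d)) ord0 (@Nf R d) f.
Definition Ac (R : realType) (d : discretization R) (c : cgrid_ghost d) :
    cline d :=
  Aop (@cemb R d) (oc1 d) (blst (oc2 d)) ord_max (@Nc R d) c.

Definition sbp2f (R : realType) (d : discretization R)
    (Sf : fgrid d -> fgrid d -> R) : Prop :=
  forall v u : fgrid d,
    ipf v (fun i j => (Jf i j)^-1 *: Lf u i j)
    = - Sf v u - ipGf (fun i => v i ord0) (fun i => (JLf i)^-1 *: Af u i).
Definition sbp2c (R : realType) (d : discretization R)
    (Sc : cgrid d -> cgrid d -> R) : Prop :=
  forall (v : cgrid d) (u : cgrid_ghost d),
    ipc v (fun i j => (Jc i j)^-1 *: Lc u i j)
    = - Sc v (noghost u)
      + ipGc (fun i => v i ord_max) (fun i => (JLc i)^-1 *: Ac u i).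

Definition interp (R : realType) (d : discretization R) (v : cline d) :
    fline d :=
  fun i => (Num.sqrt (JLf i))^-1 *:
    \sum_k Pint d i k *: (Num.sqrt (JLc k) *: v k).
Definition restr (R : realType) (d : discretization R) (v : fline d) :
    cline d :=
  fun i => (Num.sqrt (JLc i))^-1 *:
    \sum_k Rint d i k *: (Num.sqrt (JLf k) *: v k).

Definition eta (R : realType) (d : discretization R) (c : cgrid_ghost d)
    (f : fgrid d) : fline d :=
  fun i => (rhof i ord0 * Jf i ord0) *:
      interp (fun k => (rhoc k ord_max * Jc k ord_max)^-1 *: Lc c k ord_max) i
    - Lf f i ord0.

Definition Lhat (R : realType) (d : discretization R) (c : cgrid_ghost d)
    (f : fgrid d) : fgrid d :=
  fun i j => if j == ord0 then Lf f i j + eta c f i else Lf f i j.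

Definition cont_solution (R : realType) (d : discretization R)
    (c : cgrid_ghost d) (f : fgrid d) : Prop :=
  forall i, f i ord0 = interp (fun k => noghost c k ord_max) i.

Definition cont_traction (R : realType) (d : discretization R)
    (c : cgrid_ghost d) (f : fgrid d) : Prop :=
  forall i, (JLc i)^-1 *: Ac c i
    = restr (fun k => (JLf k)^-1 *:
        (Af f k - (h2 d * wt (of2 d) ord0) *: eta c f k)) i.

(* One predictor-corrector step, from times n-1 (c0, f0) and n (c1, f1) to    *)
(* time n+1 (c2, f2); (cs, fs) is the predictor.                              *)
Definition pc_step (R : realType) (d : discretization R) (dt : R)
    (c0 : cgrid_ghost d) (f0 : fgrid d) (c1 : cgrid_ghost d) (f1 : fgrid d)
    (c2 : cgrid_ghost d) (f2 : fgrid d) : Prop :=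
  exists (cs : cgrid_ghost d) (fs : fgrid d),
    let ac : cgrid_ghost d :=
      fun i j => (dt ^+ 2)^-1 *: (cs i j - 2 *: c1 i j + c0 i j) in
    let af : fgrid d :=
      fun i j => (dt ^+ 2)^-1 *: (fs i j - 2 *: f1 i j + f0 i j) in
    [/\ forall i j, noghost cs i j
          = 2 *: noghost c1 i j - noghost c0 i j
            + (dt ^+ 2 / (rhoc i j * Jc i j)) *: Lc c1 i j,
        forall i j, j != ord0 -> fs i j
          = 2 *: f1 i j - f0 i j
            + (dt ^+ 2 / (rhof i j * Jf i j)) *: Lhat c1 f1 i j,
        cont_solution cs fs
      & cont_traction cs fs] /\
    [/\ forall i j, noghost c2 i j
          = noghost cs i j
            + (dt ^+ 4 / 12 / (rhoc i j * Jc i j)) *: Lc ac i j,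
        forall i j, j != ord0 -> f2 i j
          = fs i j + (dt ^+ 4 / 12 / (rhof i j * Jf i j)) *: Lhat ac af i j,
        cont_solution c2 f2
      & cont_traction c2 f2].

Definition numerical_solution (R : realType) (d : discretization R) (dt : R)
    (c : nat -> cgrid_ghost d) (f : nat -> fgrid d) : Prop :=
  [/\ cont_solution (c 0%N) (f 0%N), cont_traction (c 0%N) (f 0%N),
      cont_solution (c 1%N) (f 1%N), cont_traction (c 1%N) (f 1%N)
    & forall n, (1 <= n)%N ->
        pc_step dt (c n.-1) (f n.-1) (c n) (f n) (c n.+1) (f n.+1)].

Definition Dt (R : realType) (m n : nat) (dt : R) (u : nat -> gridfun R m n)
    (k : nat) : gridfun R m n :=
  fun i j => dt^-1 *: (u k.+1 i j - u k i j).

(* [energy dt Sf Sc c f n] is E^{n+1/2}.                                      *)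
Definition energy (R : realType) (d : discretization R) (dt : R)
    (Sf : fgrid d -> fgrid d -> R) (Sc : cgrid d -> cgrid d -> R)
    (c : nat -> cgrid_ghost d) (f : nat -> fgrid d) (n : nat) : R :=
  let vf : fgrid d := fun i j => Num.sqrt (rhof i j) *: Dt dt f n i j in
  let vc : cgrid d := fun i j =>
    Num.sqrt (rhoc i j) *: Dt dt (fun k => noghost (c k)) n i j in
  ipf vf vf + ipc vc vc
  + Sc (noghost (c n.+1)) (noghost (c n)) + Sf (f n.+1) (f n)
  - dt ^+ 2 / 12 *
    ipf (fun i j => (Jf i j)^-1 *: Lhat (c n.+1) (f n.+1) i j)
        (fun i j => (rhof i j * Jf i j)^-1 *: Lhat (c n) (f n) i j)
  - dt ^+ 2 / 12 *
    ipc (fun i j => (Jc i j)^-1 *: Lc (c n.+1) i j)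
        (fun i j => (rhoc i j * Jc i j)^-1 *: Lc (c n) i j).

(* Degrees of freedom: grid point and vector component. Square matrices are   *)
(* indexed through [enum_rank] / [enum_val].                                  *)
Definition dof (m n : nat) : finType := ('I_m * 'I_n * 'I_2)%type.

Definition mxgrid (R : realType) (m n : nat) (K : 'M[R]_#|dof m n|)
    (u : gridfun R m n) : gridfun R m n :=
  fun i j => \col_p \sum_(t : dof m n)
    K (enum_rank ((i, j, p) : dof m n)) (enum_rank t) * u t.1.1 t.1.2 t.2 0.

(* W^(1/2) K W^(-1/2), for W the diagonal matrix of entries w i j.            *)
Definition scaledK (R : realType) (m n : nat) (w : 'I_m -> 'I_n -> R)
    (K : 'M[R]_#|dof m n|) : 'M[R]_#|dof m n| :=
  let s (a : 'I_#|dof m n|) : R :=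
    Num.sqrt (w (enum_val a).1.1 (enum_val a).1.2) in
  diag_mx (\row_a s a) *m K *m diag_mx (\row_a (s a)^-1).

Definition wrhof (R : realType) (d : discretization R) i j : R :=
  @rhof R d i j * (wt (of1 d) i * wt (of2 d) j).
Definition wrhoc (R : realType) (d : discretization R) i j : R :=
  @rhoc R d i j * (wt (oc1 d) i * wt (oc2 d) j).

Definition is_Kf (R : realType) (d : discretization R)
    (Sf : fgrid d -> fgrid d -> R)
    (K : 'M[R]_#|dof (nf1 d).+1 (nf2 d).+1|) : Prop :=
  forall v u : fgrid d,
    Sf v u = ipf v (fun i j => rhof i j *: mxgrid K u i j).
Definition is_Kc (R : realType) (d : discretization R)
    (Sc : cgrid d -> cgrid d -> R)
    (K : 'M[R]_#|dof (nc1 d).+1 (nc2 d).+1|) : Prop :=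
  forall v u : cgrid d,
    Sc v u = ipc v (fun i j => rhoc i j *: mxgrid K u i j).

(* [k] lists the eigenvalues of A, with algebraic multiplicity.               *)
Definition eigenvalues (R : realType) (n : nat) (A : 'M[R]_n)
    (k : 'I_n -> R) : Prop :=
  char_poly A = \prod_j ('X - (k j)%:P).

(* 2 sqrt 3 / max_j sqrt (k j), in \bar R where 0^-1 = +oo, so that there is  *)
(* no restriction if all the k j vanish. The maximum is of nonnegative terms. *)
Definition step_bound (R : realType) (n : nat) (k : 'I_n -> R) : \bar R :=
  ((2 * Num.sqrt 3)%:E / (\big[Num.max/0%R]_j Num.sqrt (k j))%:E)%E.

(* Main.v *)
Require Import Defs.
From mathcomp Require Import all_boot all_order all_algebra.
From mathcomp Require Import all_classical all_reals all_analysis.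
From mathcomp Require Import ring.
Import Order.TTheory GRing.Theory Num.Theory.
Local Open Scope ring_scope.
Set Implicit Arguments.
Unset Strict Implicit.
Unset Printing Implicit Defensive.

(** Put the two blocks together: a state u = (c, f) carries ghost values,
    p u is the pair of its values at proper grid points, and M u is the pair
    of discrete accelerations ((J rho)^-1 L c, (J rho)^-1 Lhat f). Let b be
    the inner product weighted by J rho and S the sum of the two strain forms.
    Everything rests on three facts.

    Green's identity ([green_identity]): b (v, M u) = - S (v, p u) as soon as v
    is continuous across the interface and u satisfies the traction condition.
    The two boundary terms left by summation by parts cancel against the term by
    which eta modifies the fine operator on the interface line: the traction
    condition turns the coarse one into an inner product with a restricted
    fine traction, and restriction is adjoint to interpolation
    ([restr_adjoint]). So the ghost values, which enter M u, do not spoil the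
    symmetry.

    The interface line obeys the interior scheme ([pc_step_modified]): on the
    fine interface line the step prescribes interpolated coarse values and not
    an update formula. But eta is chosen so that M u is itself continuous
    across the interface ([acceleration_continuous]), and a continuous pair is
    determined by its values off that line ([interface_continuous_eq]). Hence
    the corrector argument a satisfies p a = M u_n at every grid point, and
      p u_(n+1) - 2 p u_n + p u_(n-1) = dt^2 M u_n + dt^4/12 M a
    holds everywhere. As the interface conditions are linear, a and the
    differences of states inherit them, so Green's identity applies to them.

    The rest is algebra ([modified_energy_conserved]): pairing this equation,
    divided by dt^2, with w = p (u_(n+1) - u_(n-1)) gives the increment of the
    kinetic energy. Its first term b (w, M u_n) = - S (w, p u_n) is minus the
    increment of the strain energy. The second one, dt^2/12 b (w, M a)
    = - dt^2/12 S (w, p a) = dt^2/12 b (p a, M (u_(n+1) - u_(n-1))), is the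
    increment of dt^2/12 b (M u_(n+1), M u_n), which the energy subtracts,
    because p a = M u_n. *)

(** * Energy of the modified-equation scheme *)

(** The energy E^(n+1/2) for u1 = u_(n+1) and u0 = u_n. *)
Definition modified_energy (R : numFieldType) (V W : lmodType R) (p M : V -> W)
    (b S : W -> W -> R) (dt : R) (u1 u0 : V) : R :=
  b (dt^-1 *: (p u1 - p u0)) (dt^-1 *: (p u1 - p u0)) + S (p u1) (p u0)
  - dt ^+ 2 / 12 * b (M u1) (M u0).

(** A scheme u2 - 2 u1 + u0 = dt^2 M u1 + dt^4/12 M (M u1) conserves an energy
    when M is symmetric for b. Here M takes more data (ghost values) than it
    returns, p forgets that data, and M a with p a = M u1 takes the place of
    M (M u1). Then M is not an operator on one space, and the Green identities
    for the pairs that occur stand in for its symmetry. *)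
Lemma modified_energy_conserved (R : numFieldType) (V W : lmodType R)
    (p M : V -> W) (b S : W -> W -> R) (dt : R) (u2 u1 u0 a : V) :
  linear p -> linear M ->
  (forall z, scalar (b^~ z)) -> (forall x y, b x y = b y x) ->
  (forall z, scalar (S^~ z)) -> (forall x y, S x y = S y x) ->
  dt != 0 ->
  p a = M u1 ->
  p u2 - 2 *: p u1 + p u0 = dt ^+ 2 *: M u1 + (dt ^+ 4 / 12) *: M a ->
  b (p (u2 - u0)) (M u1) = - S (p (u2 - u0)) (p u1) ->
  b (p (u2 - u0)) (M a) = - S (p (u2 - u0)) (p a) ->
  b (p a) (M (u2 - u0)) = - S (p a) (p (u2 - u0)) ->
  modified_energy p M b S dt u2 u1 = modified_energy p M b S dt u1 u0.
Proof.
move=> pl Ml bl bC Sl SC dt0 pa step green1 green2 greena.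
apply/eqP; rewrite -subr_eq0.
have pB := GRing.zmod_morphism_linear pl.
have MB := GRing.zmod_morphism_linear Ml.
have bB z := GRing.zmod_morphism_linear (bl z).
have SB z := GRing.zmod_morphism_linear (Sl z).
have bZ z := GRing.scalable_linear (bl z).
set x := dt^-1 *: (p u2 - p u1); set y := dt^-1 *: (p u1 - p u0).
have diff_squares : b x x - b y y = b (x - y) (x + y).
  rewrite bB /= (bC x (x + y)) (bC y (x + y)).
  have bD z : b (x + y) z = b x z + b y z.
    by rewrite -[x]scale1r bl mul1r scale1r.
  by rewrite !bD (bC y x) addrKA.
have kinetic : b x x - b y y
    = b (p (u2 - u0)) (M u1) + dt ^+ 2 / 12 * b (p (u2 - u0)) (M a).
  rewrite diff_squares.
  (* The difference of the two discrete velocities is the second difference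
     given by the scheme; their sum is the centred difference. *)
  have -> : x + y = dt^-1 *: p (u2 - u0).
    by rewrite /x /y -scalerDr addrA subrK pB.
  have -> : x - y = dt^-1 *: (dt ^+ 2 *: M u1 + (dt ^+ 4 / 12) *: M a).
    rewrite /x /y -scalerBr -step; congr (_ *: _).
    by rewrite opprB addrACA -opprD -mulr2n -scaler_nat addrAC.
  rewrite bZ bC bZ bC bl bZ (bC (M u1)) (bC (M a)) /=.
  by field.
rewrite /modified_energy -/x -/y.
have -> : forall A B C A' B' C' : R,
    A + B - C - (A' + B' - C') = (A - A') + (B - B') - (C - C').
  by move=> *; ring.
rewrite kinetic green1 green2 -mulrBr [S (p u1) _]SC -SB (bC (M u1)) -bB.
rewrite -pB -MB -pa [X in _ - _ * X]bC greena (SC (p a)) pB.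
by apply/eqP; ring.
Qed.

(** * Linear conditions *)

Section LinearSubspace.
Variables (R : pzRingType) (V : lmodType R) (P : V -> Prop).
Hypothesis P_axpy : forall a x y, P x -> P y -> P (a *: x + y).

Lemma axpy_closedZ a x : P x -> P (a *: x).
Proof.
move=> Px; rewrite -[_ *: _]addr0; apply: P_axpy => //.
by rewrite -(addNr x) -scaleN1r; apply: P_axpy.
Qed.

Lemma axpy_closed_second_difference x y z :
  P x -> P y -> P z -> P (x - 2 *: y + z).
Proof.
move=> Px Py Pz; rewrite addrAC addrC -scaleNr.
by apply: P_axpy => //; rewrite -[x]scale1r; apply: P_axpy.
Qed.

End LinearSubspace.

Lemma second_difference_cancel (V : zmodType) (y z w : V) :
  y - z + w - y + z = w.
Proof. by rewrite addrAC (addrAC (y - z)) subrK addrC addKr. Qed.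

(** * Linearity of the difference operators *)

Lemma along1_linear (R : realType) (m m' n : nat) (A : 'M[R]_(m', m)) :
  linear (@along1 R m m' n A).
Proof.
move=> a u v; apply/funext => i; apply/funext => j.
rewrite /along1 !fctE scaler_sumr -big_split; apply: eq_bigr => k _ /=.
by rewrite scalerDr !scalerA mulrC.
Qed.

Lemma along2_linear (R : realType) (m n n' : nat) (A : 'M[R]_(n', n)) :
  linear (@along2 R m n n' A).
Proof.
move=> a u v; apply/funext => i; apply/funext => j.
rewrite /along2 !fctE scaler_sumr -big_split; apply: eq_bigr => k _ /=.
by rewrite scalerDr !scalerA mulrC.
Qed.

Lemma mulN_linear (R : realType) (m n : nat) (N : 'I_m -> 'I_n -> 'M[R]_2) :
  linear (@mulN R m n N).
Proof.
move=> a u v; apply/funext => i; apply/funext => j.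
by rewrite /mulN !fctE mulmxDr scalemxAr.
Qed.

Lemma G1op_linear (R : realType) (n1 n2 : nat) (o : sbp_ops R n1 n1.+1)
    (N : 'I_n1.+1 -> 'I_n2.+1 -> 'M[R]_2) : linear (G1op o N).
Proof.
move=> a u v; apply/funext => i; apply/funext => j; apply/matrixP => p z.
rewrite /G1op !fctE !mxE mulr_sumr -big_split; apply: eq_bigr => q _ /=.
rewrite mulr_sumr -big_split; apply: eq_bigr => k _ /=.
by rewrite !mxE mulrDr mulrCA.
Qed.

Lemma G2op_linear (R : realType) (n1 n2 m : nat) (o : sbp_ops R n2 m)
    (N : 'I_n1.+1 -> 'I_n2.+1 -> 'M[R]_2) : linear (G2op o N).
Proof.
move=> a u v; apply/funext => i; apply/funext => j; apply/matrixP => p z.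
rewrite /G2op !fctE !mxE mulr_sumr -big_split; apply: eq_bigr => q _ /=.
rewrite mulr_sumr -big_split; apply: eq_bigr => k _ /=.
by rewrite !mxE mulrDr mulrCA.
Qed.

Lemma Lop_linear (R : realType) (n1 n2 m : nat) (e : 'I_n2.+1 -> 'I_m)
    (o1 : sbp_ops R n1 n1.+1) (o2 : sbp_ops R n2 m)
    (N : 'I_2 -> 'I_2 -> 'I_n1.+1 -> 'I_n2.+1 -> 'M[R]_2) :
  linear (Lop e o1 o2 N).
Proof.
move=> a u v; apply/funext => i; apply/funext => j; rewrite /Lop !fctE.
set u0 := (fun i j => u i (e j)); set v0 := (fun i j => v i (e j)).
have -> : (fun i j => a *: u i (e j) + v i (e j)) = a *: u0 + v0 by [].
rewrite G1op_linear G2op_linear along2_linear mulN_linear along1_linear.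
rewrite along1_linear mulN_linear along2_linear !fctE.
by rewrite !scalerDr (addrACA (a *: _)) (addrACA (a *: _ + _))
  (addrACA (a *: _ + _ + _)).
Qed.

Lemma Aop_linear (R : realType) (n1 n2 m : nat) (e : 'I_n2.+1 -> 'I_m)
    (o1 : sbp_ops R n1 n1.+1) (b : 'rV[R]_m) (jG : 'I_n2.+1)
    (N : 'I_2 -> 'I_2 -> 'I_n1.+1 -> 'I_n2.+1 -> 'M[R]_2) :
  linear (Aop e o1 b jG N).
Proof.
move=> a u v; apply/funext => i; rewrite /Aop !fctE.
set u0 := (fun i j => u i (e j)); set v0 := (fun i j => v i (e j)).
have -> : (fun i j => a *: u i (e j) + v i (e j)) = a *: u0 + v0 by [].
rewrite along1_linear !fctE.
have -> : \sum_k b 0 k *: (a *: u i k + v i k)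
    = a *: (\sum_k b 0 k *: u i k) + \sum_k b 0 k *: v i k.
  rewrite scaler_sumr -big_split; apply: eq_bigr => k _ /=.
  by rewrite scalerDr !scalerA mulrC.
by rewrite !mulmxDr -!scalemxAr scalerDr addrACA.
Qed.

(** * Grid inner products *)

Lemma dotE (R : realType) (u v : 'cV[R]_2) : dot u v = \sum_p u p 0 * v p 0.
Proof. by rewrite /dot mxE; apply: eq_bigr => p _; rewrite mxE. Qed.

Lemma dotC (R : realType) (u v : 'cV[R]_2) : dot u v = dot v u.
Proof. by rewrite !dotE; apply: eq_bigr => p _; rewrite mulrC. Qed.

Lemma dot_scalar (R : realType) (v : 'cV[R]_2) : scalar ((@dot R)^~ v).
Proof.
move=> a x y; rewrite /= !dotE mulr_sumr -big_split; apply: eq_bigr => p _ /=.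
by rewrite !mxE mulrDl mulrA.
Qed.

Lemma dotZl (R : realType) a (u v : 'cV[R]_2) : dot (a *: u) v = a * dot u v.
Proof. exact: (GRing.scalable_linear (dot_scalar v)). Qed.

Lemma dotZr (R : realType) a (u v : 'cV[R]_2) : dot u (a *: v) = a * dot u v.
Proof. by rewrite dotC dotZl dotC. Qed.

Lemma dotDr (R : realType) (u v w : 'cV[R]_2) :
  dot u (v + w) = dot u v + dot u w.
Proof.
by rewrite dotC -[v]scale1r dot_scalar mul1r scale1r (dotC v) (dotC w).
Qed.

Lemma dotBr (R : realType) (u v w : 'cV[R]_2) :
  dot u (v - w) = dot u v - dot u w.
Proof. by rewrite dotDr -scaleN1r dotZr mulN1r. Qed.

Lemma dot_sumr (R : realType) (I : finType) (u : 'cV[R]_2) (F : I -> 'cV[R]_2) :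
  dot u (\sum_i F i) = \sum_i dot u (F i).
Proof.
rewrite dotE; under eq_bigr do rewrite summxE mulr_sumr.
by rewrite exchange_big; apply: eq_bigr => i _; rewrite dotE.
Qed.

Lemma eq_ip2 (R : realType) (m n : nat) (a : R) w1 w2 J
    (u v u' v' : gridfun R m n) :
  (forall i j, dot (u i j) (v i j) = dot (u' i j) (v' i j)) ->
  ip2 a w1 w2 J u v = ip2 a w1 w2 J u' v'.
Proof.
move=> e; congr (_ * _); apply: eq_bigr => i _; apply: eq_bigr => j _.
by rewrite e.
Qed.

Lemma ip2C (R : realType) (m n : nat) (a : R) w1 w2 J (u v : gridfun R m n) :
  ip2 a w1 w2 J u v = ip2 a w1 w2 J v u.
Proof. by apply: eq_ip2 => i j; rewrite dotC. Qed.

Lemma ip2_scalar (R : realType) (m n : nat) (a : R) w1 w2 J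
    (v : gridfun R m n) : scalar (fun u => ip2 a w1 w2 J u v).
Proof.
move=> b x y; rewrite /ip2 /= mulrCA -mulrDr; congr (_ * _).
rewrite mulr_sumr -big_split; apply: eq_bigr => i _.
by rewrite mulr_sumr -big_split; apply: eq_bigr => j _ /=;
  rewrite !fctE dot_scalar mulrDr mulrCA.
Qed.

(** * Positivity of the grid coefficients *)

Section Coupled.
Variables (R : realType) (d : discretization R).

Lemma h1_gt0 : 0 < h1 d.
Proof.
have := h1_nf1 d; case: (ltP 0 (h1 d)) => // h_le0 h1n.
by have := ler0n R (nf1 d) => /(mulr_le0_ge0 h_le0); rewrite h1n ler10.
Qed.

Lemma h2_gt0 : 0 < h2 d.
Proof.
have := h2_nf2 d; case: (ltP 0 (h2 d)) => // h_le0 h2n.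
by have := ler0n R (nf2 d) => /(mulr_le0_ge0 h_le0); rewrite h2n ler10.
Qed.

Lemma grid_coordinate (n : nat) (h : R) (i : 'I_n.+1) :
  0 < h -> h * n%:R = 1 -> 0 <= i%:R * h <= 1.
Proof.
move=> h0 hn; rewrite mulr_ge0 ?ler0n ?(ltW h0) //=.
have -> : (i%:R * h <= 1) = (i%:R * h <= n%:R * h) by rewrite (mulrC n%:R) hn.
by rewrite ler_pM2r // ler_nat -ltnS.
Qed.

Lemma ptf_square i j : unit_square (@ptf R d i j).
Proof.
by split; apply: grid_coordinate;
  rewrite ?h1_gt0 ?h2_gt0 ?h1_nf1 ?h2_nf2.
Qed.

Lemma ptc_square i j : unit_square (@ptc R d i j).
Proof.
by split; apply: grid_coordinate;
  rewrite ?mulr_gt0 ?h1_gt0 ?h2_gt0 ?h1_nc1 ?h2_nc2.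
Qed.

Lemma Jf_gt0 i j : 0 < @Jf R d i j.
Proof. exact: bjac_gt0 (ptf_square i j). Qed.

Lemma Jc_gt0 i j : 0 < @Jc R d i j.
Proof. exact: bjac_gt0 (ptc_square i j). Qed.

Lemma rhof_gt0 i j : 0 < @rhof R d i j.
Proof. exact: brho_gt0 (ptf_square i j). Qed.

Lemma rhoc_gt0 i j : 0 < @rhoc R d i j.
Proof. exact: brho_gt0 (ptc_square i j). Qed.

Lemma JLf_gt0 i : 0 < @JLf R d i.
Proof.
by apply: mulr_gt0 (Jf_gt0 _ _) _; apply: bmetric_gt0 (ptf_square _ _).
Qed.

Lemma JLc_gt0 i : 0 < @JLc R d i.
Proof.
by apply: mulr_gt0 (Jc_gt0 _ _) _; apply: bmetric_gt0 (ptc_square _ _).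
Qed.

(** * States, accelerations and interface conditions *)

Lemma scaled_mx_linear (m n : nat) (A : 'M[R]_(m, n)) (p : 'I_m -> R)
    (q : 'I_n -> R) :
  linear ((fun v i => p i *: \sum_k A i k *: (q k *: v k)) :
    linefun R n -> linefun R m).
Proof.
move=> a u v; apply/funext => i; rewrite !fctE scalerA mulrC -scalerA -scalerDr.
congr (_ *: _); rewrite scaler_sumr -big_split; apply: eq_bigr => k _ /=.
by rewrite !scalerDr !scalerA; congr (_ *: _ + _); ring.
Qed.

Lemma interp_linear : linear (@interp R d).
Proof. exact: scaled_mx_linear. Qed.

Lemma restr_linear : linear (@restr R d).
Proof. exact: scaled_mx_linear. Qed.

Lemma Lc_linear : linear (@Lc R d).
Proof. exact: Lop_linear. Qed.

Lemma Ac_linear : linear (@Ac R d).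
Proof. exact: Aop_linear. Qed.

Lemma Af_linear : linear (@Af R d).
Proof. exact: Aop_linear. Qed.

Lemma Lf_linear : linear (@Lf R d).
Proof. exact: Lop_linear. Qed.

(** The operators read a [state], ghost values included; what they return, and
    what the inner products and strain forms see, is a [fields]. *)
Definition state := (cgrid_ghost d * fgrid d)%type.
Definition fields := (cgrid d * fgrid d)%type.

Lemma eta_linear : linear (fun u : state => eta u.1 u.2).
Proof.
move=> a u v; apply/funext => i; rewrite /eta /= Lc_linear Lf_linear !fctE.
set x := (fun k => _ *: Lc u.1 k _); set y := (fun k => _ *: Lc v.1 k _).
have -> : (fun k : 'I_(nc1 d).+1 => (rhoc k ord_max * Jc k ord_max)^-1 *:
    (a *: Lc u.1 k ord_max + Lc v.1 k ord_max)) = a *: x + y.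
  by apply/funext => k; rewrite !fctE scalerDr !scalerA mulrC.
rewrite interp_linear !fctE; move: (interp x i) (interp y i) => X Y.
move: (Lf u.2 i ord0) (Lf v.2 i ord0) => F G.
by rewrite !(scalerDr, scalerN, scalerA) (mulrC a) opprD addrACA.
Qed.

Lemma Lhat_linear : linear (fun u : state => Lhat u.1 u.2).
Proof.
move=> a u v; apply/funext => i; apply/funext => j; rewrite /Lhat !fctE.
have := eta_linear a u v => /(congr1 (fun g => g i)) /= ->.
rewrite Lf_linear !fctE; case: ifP => // _.
by rewrite [a *: (Lf _ _ _ + _)]scalerDr addrACA.
Qed.

Definition no_ghost (u : state) : fields := (noghost u.1, u.2).

Definition acceleration (u : state) : fields :=
  (fun i j => (rhoc i j * Jc i j)^-1 *: Lc u.1 i j,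
   fun i j => (rhof i j * Jf i j)^-1 *: Lhat u.1 u.2 i j).

(** The inner products contain the Jacobian only, so the density completes the
    weight to J rho, for which the acceleration is symmetric. *)
Definition mass (x y : fields) : R :=
  ipf x.2 (fun i j => rhof i j *: y.2 i j)
  + ipc x.1 (fun i j => rhoc i j *: y.1 i j).

Definition interface_continuous (x : fields) : Prop :=
  forall i, x.2 i ord0 = interp (fun k => x.1 k ord_max) i.

Lemma no_ghost_linear : linear no_ghost.
Proof. by []. Qed.

Lemma acceleration_linear : linear acceleration.
Proof.
move=> a u v; rewrite [RHS]surjective_pairing [LHS]/acceleration.
apply: f_equal2; apply/funext => i; apply/funext => j.
  by rewrite /= Lc_linear !fctE scalerDr !scalerA mulrC.
have := Lhat_linear a u v => /= ->.
by rewrite !fctE scalerDr !scalerA mulrC.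
Qed.

Lemma mass_scalar (y : fields) : scalar (mass^~ y).
Proof.
by move=> a u v; rewrite /mass /ipf /ipc !ip2_scalar mulrDr addrACA.
Qed.

Lemma massC (x y : fields) : mass x y = mass y x.
Proof.
rewrite /mass; congr (_ + _); rewrite [LHS]ip2C; apply: eq_ip2 => i j;
  by rewrite dotZl dotZr.
Qed.

Lemma interface_continuous_closed (a : R) (x y : fields) :
  interface_continuous x -> interface_continuous y ->
  interface_continuous (a *: x + y).
Proof.
move=> mx my i; rewrite /= !fctE mx my.
by rewrite -[LHS]/((a *: interp _ + interp _) i) -interp_linear.
Qed.

(** The scheme has update formulas off the fine interface line only; on that
    line two pairs can be identified by continuity alone. *)
Lemma interface_continuous_eq (x y : fields) :
  interface_continuous x -> interface_continuous y -> x.1 = y.1 ->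
  (forall i j, j != ord0 -> x.2 i j = y.2 i j) -> x = y.
Proof.
case: x y => [xc xf] [yc yf] mx my /= ec ef; rewrite ec in mx *.
apply: f_equal2; apply/funext => i; apply/funext => j //.
by have [->|/ef] := eqVneq j ord0; [exact: etrans (mx i) (esym (my i))|].
Qed.

(** The fine traction corrected by eta: the interface values of the fine
    equation carry the extra force eta, and h2 times the first weight is the
    width of the interface line in the fine inner product. *)
Definition fine_traction (u : state) : fline d := fun k =>
  (JLf k)^-1 *: (Af u.2 k - (h2 d * wt (of2 d) ord0) *: eta u.1 u.2 k).

Lemma fine_traction_linear : linear fine_traction.
Proof.
have comb (t s a : R) (F G E1 E2 : 'cV[R]_2) :
    t *: (a *: F + G - s *: (a *: E1 + E2))
    = a *: (t *: (F - s *: E1)) + t *: (G - s *: E2).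
  rewrite [a *: (t *: _)]scalerA (mulrC a) -scalerA -scalerDr; congr (_ *: _).
  by rewrite !(scalerDr, scalerN) opprD !scalerA (mulrC s) addrACA.
move=> a u v; apply/funext => k; rewrite [LHS]/fine_traction [u in Af u]/=.
rewrite Af_linear.
have := eta_linear a u v => /(congr1 (fun g => g k)) /= ->.
exact: comb.
Qed.

Definition coarse_traction (c : cgrid_ghost d) : cline d := fun i =>
  (JLc i)^-1 *: Ac c i.

Lemma coarse_traction_linear : linear coarse_traction.
Proof.
move=> a u v; apply/funext => i; rewrite /coarse_traction Ac_linear.
by rewrite [LHS]scalerDr scalerA mulrC -scalerA.
Qed.

Definition traction_matched (u : state) : Prop :=
  coarse_traction u.1 = restr (fine_traction u).

Lemma cont_tractionE c f : cont_traction c f <-> traction_matched (c, f).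
Proof. by split=> [t|t i]; [apply/funext|apply: (congr1 (fun g => g i) t)]. Qed.

Lemma traction_matched_closed (a : R) (u v : state) :
  traction_matched u -> traction_matched v -> traction_matched (a *: u + v).
Proof.
move=> tu tv; rewrite /traction_matched fine_traction_linear restr_linear.
by rewrite -tu -tv -coarse_traction_linear.
Qed.

(** * Green's identity *)

Lemma compat_entry i k :
  h1 d * (wt (of1 d) i * Pint d i k)
  = 2 * h1 d * (wt (oc1 d) k * Defs.Rint d k i).
Proof.
have := @int_compat R d (delta_mx i 0) (delta_mx k 0).
have delta_entry m n (A : 'M[R]_(m, n)) a b :
    ((delta_mx a 0 : 'cV[R]_m)^T *m A *m (delta_mx b 0 : 'cV[R]_n)) 0 0 = A a b.
  by rewrite trmx_delta -rowE -colE !mxE.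
rewrite -!(mulmxA _ (diag_mx _)) !delta_entry.
by rewrite !mul_diag_mx !mxE.
Qed.

(** The scaling by square roots of J Lambda is there for this: the weights of
    the two interface inner products are split evenly between the two sides,
    and what remains is the compatibility of P and R. *)
Lemma restr_adjoint (v : cline d) (x : fline d) :
  ipGc v (restr x) = ipGf (interp v) x.
Proof.
rewrite /ipGc /ipGf /ipG !mulr_sumr.
pose F i k := 2 * h1 d * (wt (oc1 d) i * Defs.Rint d i k) *
  (Num.sqrt (JLc i) * Num.sqrt (JLf k) * dot (v i) (x k)).
have sqrt_quot (t z : R) : 0 < t -> t * ((Num.sqrt t)^-1 * z) = Num.sqrt t * z.
  move=> t0; rewrite -[X in X * _ = _](sqr_sqrtr (ltW t0)) expr2 -mulrA.
  by rewrite mulVKf // sqrtr_eq0 -ltNge.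
transitivity (\sum_i \sum_k F i k).
  apply: eq_bigr => i _; rewrite dotZr -(mulrA (wt _ _)) sqrt_quot ?JLc_gt0 //.
  rewrite dot_sumr !mulr_sumr; apply: eq_bigr => k _; rewrite !dotZr /F; ring.
rewrite exchange_big; apply: eq_bigr => k _ /=.
rewrite dotC dotZr -(mulrA (wt _ _)) sqrt_quot ?JLf_gt0 // dot_sumr !mulr_sumr.
by apply: eq_bigr => i _; rewrite !dotZr /F -compat_entry (dotC (x k)); ring.
Qed.

(** A source supported on the interface line is seen by the fine inner product
    as a boundary traction, so the traction condition can absorb eta. *)
Lemma ipf_interface (v w : fgrid d) (g : fline d) :
  ipf v (fun i j => (Jf i j)^-1 *: (if j == ord0 then w i j + g i else w i j))
  = ipf v (fun i j => (Jf i j)^-1 *: w i j)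
    + ipGf (fun i => v i ord0)
        (fun i => (JLf i)^-1 *: ((h2 d * wt (of2 d) ord0) *: g i)).
Proof.
rewrite /ipf /ipGf /ip2 /ipG !mulr_sumr -big_split; apply: eq_bigr => i _ /=.
rewrite (bigD1 ord0) //= [in RHS](bigD1 ord0) //=.
rewrite (eq_bigr (fun j => wt (of1 d) i * wt (of2 d) j * Jf i j
  * dot (v i j) ((Jf i j)^-1 *: w i j))) => [|j /negbTE -> //].
rewrite scalerDr dotDr !dotZr; field.
by rewrite !gt_eqF ?Jf_gt0 ?JLf_gt0.
Qed.

Lemma mass_acceleration (v : fields) (u : state) :
  mass v (acceleration u)
  = ipf v.2 (fun i j => (Jf i j)^-1 *: Lhat u.1 u.2 i j)
    + ipc v.1 (fun i j => (Jc i j)^-1 *: Lc u.1 i j).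
Proof.
congr (_ + _); apply: eq_ip2 => i j; rewrite /= scalerA invfM mulVKf //.
  by rewrite gt_eqF ?rhof_gt0.
by rewrite gt_eqF ?rhoc_gt0.
Qed.

Variables (Sf : fgrid d -> fgrid d -> R) (Sc : cgrid d -> cgrid d -> R).

Definition strain (x y : fields) : R := Sc x.1 y.1 + Sf x.2 y.2.

(** Both boundary terms become inner products of the interface values of the
    fine component of v with a fine traction: the fine one directly, with the
    eta term of [ipf_interface], the coarse one through the traction condition,
    [restr_adjoint] and the continuity of v. They are opposite. *)
Lemma green_identity (v : fields) (u : state) :
  sbp2f Sf -> sbp2c Sc -> interface_continuous v -> traction_matched u ->
  mass v (acceleration u) = - strain v (no_ghost u).
Proof.
move=> Sf_sbp Sc_sbp mv tu.
rewrite mass_acceleration ipf_interface Sf_sbp Sc_sbp -/(coarse_traction u.1).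
rewrite tu restr_adjoint.
have -> : interp (fun i => v.1 i ord_max) = (fun i => v.2 i ord0).
  by apply/funext => i; rewrite mv.
have -> : ipGf (fun i => v.2 i ord0) (fine_traction u)
   = ipGf (fun i => v.2 i ord0) (fun i => (JLf i)^-1 *: Af u.2 i)
   - ipGf (fun i => v.2 i ord0)
        (fun i => (JLf i)^-1 *: ((h2 d * wt (of2 d) ord0) *: eta u.1 u.2 i)).
  rewrite /ipGf /ipG -mulrBr -sumrB; congr (_ * _); apply: eq_bigr => i _.
  by rewrite /fine_traction scalerBr dotBr mulrBr.
by rewrite /strain /no_ghost /=; ring.
Qed.

(** * The time step *)

(** On the interface line Lf cancels in Lf + eta, leaving J rho times the
    interpolated coarse acceleration. *)
Lemma acceleration_continuous (u : state) :
  interface_continuous (acceleration u).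
Proof.
move=> i; rewrite /= /Lhat eqxx /eta addrC subrK scalerA mulVf ?scale1r //.
by rewrite gt_eqF // mulr_gt0 ?rhof_gt0 ?Jf_gt0.
Qed.

Definition admissible (u : state) : Prop :=
  interface_continuous (no_ghost u) /\ traction_matched u.

Lemma admissible_intro c f :
  cont_solution c f -> cont_traction c f -> admissible (c, f).
Proof. by move=> ms mt; split; last exact/cont_tractionE. Qed.

Lemma admissible_closed (a : R) (u v : state) :
  admissible u -> admissible v -> admissible (a *: u + v).
Proof.
move=> [mu tu] [mv tv]; split; last exact: traction_matched_closed.
by rewrite no_ghost_linear; apply: interface_continuous_closed.
Qed.

(** The witness a is the second difference of the predictor. Off the interface
    line both equations are the update formulas of the step; on it they follow
    from the continuity of all the pairs involved. *)
Lemma pc_step_modified (dt : R) (c0 : cgrid_ghost d) (f0 : fgrid d)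
    (c1 : cgrid_ghost d) (f1 : fgrid d) (c2 : cgrid_ghost d) (f2 : fgrid d) :
  dt != 0 -> admissible (c0, f0) -> admissible (c1, f1) ->
  pc_step dt c0 f0 c1 f1 c2 f2 ->
  admissible (c2, f2) /\ exists a : state,
    [/\ admissible a, no_ghost a = acceleration (c1, f1)
      & no_ghost (c2, f2) - 2 *: no_ghost (c1, f1) + no_ghost (c0, f0)
        = dt ^+ 2 *: acceleration (c1, f1) + (dt ^+ 4 / 12) *: acceleration a].
Proof.
move=> dt0 adm0 adm1 [cs [fs [[csE fsE ms ts] [c2E f2E m2 t2]]]].
have adm_s : admissible (cs, fs) by exact: admissible_intro.
have adm2 : admissible (c2, f2) by exact: admissible_intro.
split=> //.
pose a : state := (dt ^+ 2)^-1 *: ((cs, fs) - 2 *: (c1, f1) + (c0, f0)).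
have adm_a : admissible a.
  apply: (axpy_closedZ admissible_closed).
  exact: (axpy_closed_second_difference admissible_closed adm_s adm1 adm0).
have dt2V (k : R) : (dt ^+ 2)^-1 * (dt ^+ 2 / k) = k^-1.
  by rewrite mulKf ?expf_neq0.
have aE : no_ghost a = acceleration (c1, f1).
  apply: interface_continuous_eq (acceleration_continuous _) _ _.
    exact: adm_a.1.
    apply/funext => i; apply/funext => j.
    have -> : (no_ghost a).1 i j = (dt ^+ 2)^-1 *:
      (noghost cs i j - 2 *: noghost c1 i j + noghost c0 i j) by [].
    by rewrite csE second_difference_cancel scalerA dt2V.
  move=> i j j0.
  have -> : (no_ghost a).2 i j = (dt ^+ 2)^-1 *:
    (fs i j - 2 *: f1 i j + f0 i j) by [].
  by rewrite fsE // second_difference_cancel scalerA dt2V.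
exists a; split=> //; apply: interface_continuous_eq.
- exact: (axpy_closed_second_difference interface_continuous_closed
    adm2.1 adm1.1 adm0.1).
- apply: interface_continuous_closed; first exact: acceleration_continuous.
  apply: (axpy_closedZ interface_continuous_closed).
  exact: acceleration_continuous.
- apply/funext => i; apply/funext => j.
  rewrite -[LHS]/(noghost c2 i j - 2 *: noghost c1 i j + noghost c0 i j).
  rewrite c2E csE -(addrA (_ - noghost c0 i j)) second_difference_cancel.
  by rewrite /= !fctE !scalerA.
move=> i j j0.
rewrite -[LHS]/(f2 i j - 2 *: f1 i j + f0 i j).
rewrite f2E // fsE // -(addrA (_ - f0 i j)) second_difference_cancel.
by rewrite /= !fctE !scalerA.
Qed.

Lemma strain_scalar (y : fields) :
  sym_psd_form Sf -> sym_psd_form Sc -> scalar (strain^~ y).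
Proof.
move=> [Sfl _ _] [Scl _ _] a u v; rewrite /strain /= mulrDr addrACA.
by congr (_ + _); [apply: Scl|apply: Sfl].
Qed.

Lemma strainC (x y : fields) :
  sym_psd_form Sf -> sym_psd_form Sc -> strain x y = strain y x.
Proof. by move=> [_ SfC _] [_ ScC _]; rewrite /strain SfC ScC. Qed.

Lemma energyE (dt : R) (c : nat -> cgrid_ghost d) (f : nat -> fgrid d) n :
  energy dt Sf Sc c f n
  = modified_energy no_ghost acceleration mass strain dt
      (c n.+1, f n.+1) (c n, f n).
Proof.
have sqrtK (r : R) (u v : 'cV[R]_2) : 0 < r ->
    dot (Num.sqrt r *: u) (Num.sqrt r *: v) = dot u (r *: v).
  by move=> r0; rewrite dotZl !dotZr mulrA -expr2 sqr_sqrtr ?ltW.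
rewrite /energy /modified_energy.
have -> : mass (dt^-1 *: (no_ghost (c n.+1, f n.+1) - no_ghost (c n, f n)))
    (dt^-1 *: (no_ghost (c n.+1, f n.+1) - no_ghost (c n, f n)))
  = ipf (fun i j => Num.sqrt (rhof i j) *: Dt dt f n i j)
      (fun i j => Num.sqrt (rhof i j) *: Dt dt f n i j)
  + ipc (fun i j => Num.sqrt (rhoc i j)
        *: Dt dt (fun k => noghost (c k)) n i j)
      (fun i j => Num.sqrt (rhoc i j)
        *: Dt dt (fun k => noghost (c k)) n i j).
  by congr (_ + _); apply: eq_ip2 => i j; rewrite sqrtK ?rhof_gt0 ?rhoc_gt0.
rewrite massC mass_acceleration /ipf /ipc.
rewrite [X in _ - _ * (X + _)]ip2C [X in _ - _ * (_ + X)]ip2C.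
by rewrite /strain mulrDr opprD !addrA.
Qed.

End Coupled.

Theorem theorem2 (R : realType) (d : discretization R)
  (Sf : fgrid d -> fgrid d -> R) (Sc : cgrid d -> cgrid d -> R)
  (Sf_form : sym_psd_form Sf) (Sc_form : sym_psd_form Sc)
  (Sf_sbp : sbp2f Sf) (Sc_sbp : sbp2c Sc)
  (Kf : 'M[R]_#|dof (nf1 d).+1 (nf2 d).+1|)
  (Kc : 'M[R]_#|dof (nc1 d).+1 (nc2 d).+1|)
  (Kf_def : is_Kf Sf Kf) (Kc_def : is_Kc Sc Kc)
  (kappaf : 'I_#|dof (nf1 d).+1 (nf2 d).+1| -> R)
  (kappac : 'I_#|dof (nc1 d).+1 (nc2 d).+1| -> R)
  (kappaf_eig : eigenvalues (scaledK (@wrhof R d) Kf) kappaf)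
  (kappac_eig : eigenvalues (scaledK (@wrhoc R d) Kc) kappac)
  (dt : R) (dt_gt0 : 0 < dt)
  (dt_le : (dt%:E <= Order.min (step_bound kappaf) (step_bound kappac))%E)
  (c : nat -> cgrid_ghost d) (f : nat -> fgrid d)
  (sol : numerical_solution dt c f) :
  forall n : nat, (1 <= n)%N ->
    energy dt Sf Sc c f n = energy dt Sf Sc c f n.-1.
Proof.
have [c0s c0t c1s c1t steps] := sol.
have dt0 : dt != 0 by rewrite gt_eqF.
have adm n : admissible (c n, f n) /\ admissible (c n.+1, f n.+1).
  elim: n => [|n [adm0 adm1]].
    by split; apply: admissible_intro.
  split; first exact: adm1.
  by have [] := pc_step_modified dt0 adm0 adm1 (steps n.+1 isT).
case=> // n _; rewrite !energyE /=.
have [adm0 adm1] := adm n; have [_ adm2] := adm n.+1.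
have [_ [a [adma aE stepE]]] := pc_step_modified dt0 adm0 adm1 (steps n.+1 isT).
have admd : admissible ((c n.+2, f n.+2) - (c n, f n)).
  rewrite addrC -scaleN1r; exact: admissible_closed.
have green v u : admissible v -> admissible u ->
    mass (no_ghost v) (acceleration u)
    = - strain Sf Sc (no_ghost v) (no_ghost u).
  by move=> [mv _] [_ tu]; apply: green_identity.
apply: (modified_energy_conserved (@no_ghost_linear R d)
  (@acceleration_linear R d) (@mass_scalar R d) (@massC R d) _ _ dt0 aE stepE
  (green _ _ admd adm1) (green _ _ admd adma) (green _ _ adma admd)).
  by move=> z; apply: strain_scalar.
by move=> x y; apply: strainC.
Qed.
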